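(* Let $n\ge1$. There is a one-to-one correspondence between descending multiplications on $\mathbb{F}_2^n$ and $n$-qubit staircase form permutation gates in $\mathcal{C}_3$, given by the following two mutually inverse maps. (i) To a descending multiplication (written by juxtaposition) associate the permutation gate $\pi$ given by $$\pi\Big|\sum_{i\in S}e_i\Big\rangle=\Big|\sum_{T\subseteq S,\ T\ne\varnothing}\ \prod_{i\in T}e_i\Big\rangle\qquad\text{for all } S\subseteq[n];$$ this $\pi$ is a staircase form permutation gate in $\mathcal{C}_3$. (ii) To a staircase form permutation gate $\pi\in\mathcal{C}_3$ associate the operation on $\mathbb{F}_2^n$ in which, for all $i,j\in[n]$, the product $e_ie_j$ is defined by $$\pi|e_i+e_j\rangle=|e_i+e_j+e_ie_j\rangle,$$ extended bilinearly to $\mathbb{F}_2^n\times\mathbb{F}_2^n$; this operation is a descending multiplication.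
   Context: $e_1,\dots,e_n$ is the standard basis of $\mathbb{F}_2^n$. A map $\mathbb{F}_2^n\times\mathbb{F}_2^n\to\mathbb{F}_2^n$, denoted by juxtaposition, is a descending multiplication if it is linear in each coordinate, associative and commutative; $e_ie_i=0$ for all $i\in[n]$; and for all $i<j$ in $[n]$, $e_ie_j$ lies in the span of $\{e_k:k>j\}$. Gates are unitary operators on $(\mathbb{C}^2)^{\otimes n}$, with computational basis $\{|v\rangle : v\in\mathbb{F}_2^n\}$. The Pauli group $\mathcal{P}_n$ consists of all $cP_1\otimes\cdots\otimes P_n$ with $c\in\{\pm1,\pm i\}$ and $P_j\in\{I_2,X,Y,Z\}$. The Clifford hierarchy: $\mathcal{C}_1=\mathcal{P}_n$, and for $k\ge2$, $\mathcal{C}_k$ is the set of unitaries $U$ with $UPU^\dagger\in\mathcal{C}_{k-1}$ for all $P\in\mathcal{P}_n$. A permutation gate is a unitary whose matrix in the computational basis is a $2^n\times2^n$ permutation matrix. For distinct $i,j,k\in[n]$, the Toffoli gate $\mathrm{Tof}_{i,j,k}$ is the permutation gate sending $|a_1,\dots,a_n\rangle$ to the basis state with $a_k$ replaced by $a_k+a_ia_j$ and all other coordinates unchanged; $k$ is its target. A (possibly empty) product of pairwise distinct Toffoli gates is in staircase form if each gate $\mathrm{Tof}_{i,j,k}$ in the product has $i<j<k$ and the targets are nondecreasing in the order in which the gates are applied. A permutation gate is in staircase form if it can be written as such a product. *)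

(* Defs.v *)
From HB Require Import structures.
From mathcomp Require Import all_boot all_order all_algebra.

Set Implicit Arguments.
Unset Strict Implicit.
Unset Printing Implicit Defensive.

Import GRing.Theory Num.Theory.
Local Open Scope ring_scope.
Local Open Scope sesquilinear_scope.

Notation vec n := 'rV['F_2]_n.

Definition e {n : nat} (i : 'I_n) : vec n := delta_mx 0 i.

Definition bilinear_op {n : nat} (m : vec n -> vec n -> vec n) : Prop :=
  (forall x, linear (m x)) /\ (forall y, linear (m^~ y)).

Definition descending {n : nat} (m : vec n -> vec n -> vec n) : Prop :=
  [/\ bilinear_op m, associative m, commutative m,
      forall i : 'I_n, m (e i) (e i) = 0
    & forall i j : 'I_n, (i < j)%N ->
        m (e i) (e j) \in <<[seq e k | k : 'I_n <- enum 'I_n & (j < k)%N]>>%VS].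

Definition descending_mul (n : nat) := {m : vec n -> vec n -> vec n | descending m}.

(** The product of the [e i], [i \in T], taken in increasing order of [i].
    The multiplication has no unit: the value at [T = set0] is junk. *)
Definition eprod {n : nat} (m : vec n -> vec n -> vec n) (T : {set 'I_n}) : vec n :=
  if enum T is i :: s then foldl (fun x j => m x (e j)) (e i) s else 0.

Section Gates.
Variables (C : numClosedFieldType) (n : nat).

(** The rows and columns of an operator on n qubits are indexed, through
    [enum_rank] and [label], by the 2^n vectors of F_2^n. *)
Definition operator := 'M[C]_#|{: vec n}|.

Definition ket (v : vec n) : 'cV[C]_#|{: vec n}| := delta_mx (enum_rank v) 0.

Definition label (a : 'I_#|{: vec n}|) : vec n := enum_val a.

(** The entry of a tensor product at (v, w) is the product over j of the
    entries of the factors at (v_j, w_j). *)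
Definition tensor (P : 'I_n -> 'M[C]_2) : operator :=
  \matrix_(a, b) \prod_(j < n) P j (label a 0 j) (label b 0 j).

Definition mx22 (a b c d : C) : 'M[C]_2 :=
  \matrix_(i, j) if i == 0 then (if j == 0 then a else b)
                 else (if j == 0 then c else d).

Definition pauliX := mx22 0 1 1 0.
Definition pauliY := mx22 0 (- 'i) 'i 0.
Definition pauliZ := mx22 1 0 0 (-1).

Definition pauli_group (U : operator) : Prop :=
  exists (c : C) (P : 'I_n -> 'M[C]_2),
    [/\ c \in [:: 1; -1; 'i; - 'i],
        forall j, P j \in [:: 1%:M; pauliX; pauliY; pauliZ]
      & U = c *: tensor P].

(** The hierarchy starts at level 1: level 0 is empty by convention. *)
Fixpoint clifford (k : nat) (U : operator) {struct k} : Prop :=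
  match k with
  | 0 => False
  | k'.+1 =>
      if k' is 0 then pauli_group U
      else U \is unitarymx /\
           forall P, pauli_group P -> clifford k' (U *m P *m U ^t*)
  end.

Definition permutation_gate (U : operator) : Prop :=
  U \is unitarymx /\ is_perm_mx U.

Definition toffoli (i j k : 'I_n) : operator :=
  let f (v : vec n) : vec n :=
    \row_l (if l == k then v 0 k + v 0 i * v 0 j else v 0 l) in
  \matrix_(a, b) (label a == f (label b))%:R.

(** The triple ((i, j), k) stands for the gate Tof_{i,j,k}; the head of a list
    of gates is the gate applied first. *)
Definition tof (t : 'I_n * 'I_n * 'I_n) : operator := toffoli t.1.1 t.1.2 t.2.

Definition circuit (s : seq ('I_n * 'I_n * 'I_n)) : operator :=
  foldl (fun U t => tof t *m U) 1%:M s.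

Definition staircase (U : operator) : Prop :=
  permutation_gate U /\
  exists s : seq ('I_n * 'I_n * 'I_n),
    [/\ all (fun t : 'I_n * 'I_n * 'I_n => (t.1.1 < t.1.2 < t.2)%N) s,
        uniq [seq tof t | t <- s],
        sorted (fun t u : 'I_n * 'I_n * 'I_n => (t.2 <= u.2)%N) s
      & U = circuit s].

Definition staircase_C3 := {U : operator | staircase U /\ clifford 3 U}.

Definition gate_of_mul (m : vec n -> vec n -> vec n) (U : operator) : Prop :=
  forall S : {set 'I_n},
    U *m ket (\sum_(i in S) e i) =
    ket (\sum_(T : {set 'I_n} | (T \subset S) && (T != set0)) eprod m T).

Definition mul_of_gate (U : operator) (m : vec n -> vec n -> vec n) : Prop :=
  bilinear_op m /\
  forall i j : 'I_n, U *m ket (e i + e j) = ket (e i + e j + m (e i) (e j)).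

End Gates.

(* Main.v *)
Require Import Defs.
From HB Require Import structures.
From mathcomp Require Import all_boot all_order all_algebra.
From mathcomp Require Import reals complex boolp.

Set Implicit Arguments.
Unset Strict Implicit.
Unset Printing Implicit Defensive.

(** Adjoin a unit to the algebra given by a descending multiplication. Since
    [x * x = 0], the operation [circ x y = x + y + x * y], that is
    [(1 + x) * (1 + y) - 1], makes F_2^n an elementary abelian 2-group, and
    the map [pi] of (i) is the isomorphism from (F_2^n, +) to (F_2^n, circ)
    fixing every [e i]. Conjugating by [pi] turns translation by [u] into the
    affine map [y |-> circ y (pi u)], and a sign [l] into the phase [l o pi^-1],
    which is quadratic because [pi^-1 (x + y) = pi^-1 x + pi^-1 y + pi^-1 (x * y)];
    both lie in C_2. The quadratic coefficients of [pi^-1] are exactly the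
    Toffoli gates of the staircase form: gates with nondecreasing targets see
    the final values of their controls.

    Conversely, if [pi] is in C_3 then [y |-> pi (pi^-1 y + e i)] is affine,
    hence [pi (v + e i) = e i + pi v + e i * pi v]; exchanging the order in which
    [e i] and [e j] are added gives [e i * (e j * x) = e j * (e i * x)], which with
    commutativity is associativity. *)

Import GRing.Theory Num.Theory.
Local Open Scope ring_scope.

(** * Vectors over F_2 and their filtration by leading zeros *)

Lemma F2_cases (a : 'F_2) : a = 0 \/ a = 1.
Proof. by case: a => [[|[|//]] ?]; [left | right]; apply: val_inj. Qed.

Section Vectors.
Variable n : nat.
Implicit Types (x y v w : vec n) (i j k : 'I_n).

Lemma vecDD v : v + v = 0.
Proof. by apply/rowP => i; rewrite !mxE; case: (F2_cases (v 0 i)) => ->; apply: val_inj. Qed.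

Lemma vecDK v w : v + w + w = v.
Proof. by rewrite -addrA vecDD addr0. Qed.

Lemma addv_eq0 v w : v + w = 0 -> v = w.
Proof. by move=> vw0; rewrite -[v](vecDK _ w) vw0 add0r. Qed.

Lemma eE i j : (e i : vec n) 0 j = (j == i)%:R.
Proof. by rewrite mxE eqxx. Qed.

Lemma vec_sum v : v = \sum_i v 0 i *: e i.
Proof. exact: row_sum_delta. Qed.

Lemma vec_ind (P : vec n -> Prop) :
  P 0 -> (forall i v, P v -> P (v + e i)) -> forall v, P v.
Proof.
move=> P0 PD v; rewrite (vec_sum v); elim/big_rec: _ => // i x _ Px.
case: (F2_cases (v 0 i)) => ->; first by rewrite scale0r add0r.
by rewrite scale1r addrC; apply: PD.
Qed.

Lemma additive_ext (V : zmodType) (g h : vec n -> V) :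
  {morph g : x y / x + y} -> {morph h : x y / x + y} ->
  (forall i, g (e i) = h (e i)) -> g =1 h.
Proof.
move=> gD hD gh; have z0 (k : vec n -> V) : {morph k : x y / x + y} -> k 0 = 0.
  by move=> kD; apply: (addrI (k 0)); rewrite -kD !addr0.
apply: vec_ind => [|i v IH]; first by rewrite !z0.
by rewrite gD hD IH gh.
Qed.

(** The span of the [e k] with [k > j], put as a condition on coordinates; [upper_span] makes the
    link. *)
Definition upper (j : nat) v := forall k, (k <= j)%N -> v 0 k = 0.

Lemma upper0 (j : nat) : upper j 0.
Proof. by move=> k _; rewrite mxE. Qed.

Lemma upperD (j : nat) v w : upper j v -> upper j w -> upper j (v + w).
Proof. by move=> uv uw k kj; rewrite mxE uv ?uw ?addr0. Qed.

Lemma upperZ (j : nat) a v : upper j v -> upper j (a *: v).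
Proof. by move=> uv k kj; rewrite mxE uv ?mulr0. Qed.

Lemma upper_e (j : nat) i : (j < i)%N -> upper j (e i).
Proof.
by move=> ji k kj; rewrite eE (_ : (k == i) = false) // -val_eqE ltn_eqF ?(leq_ltn_trans kj).
Qed.

Lemma upper_sum (j : nat) (I : Type) (r : seq I) (P : pred I) (F : I -> vec n) :
  (forall a, P a -> upper j (F a)) -> upper j (\sum_(a <- r | P a) F a).
Proof. by move=> uF; elim/big_ind: _ => //; [apply: upper0 | apply: upperD]. Qed.

Lemma upper_span (j : 'I_n) v :
  v \in <<[seq e k | k : 'I_n <- enum 'I_n & (j < k)%N]>>%VS <-> upper j v.
Proof.
set X := [seq _ | _ <- _ & _]; split=> [vX | uv].
  have {}vX : v \in <<in_tuple X>>%VS by [].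
  rewrite (coord_span vX); apply: upper_sum => a _; apply: upperZ.
  have /mapP[k] : (in_tuple X)`_a \in X by apply: mem_nth.
  by rewrite mem_filter => /andP[jk _] ->; apply: upper_e.
rewrite (vec_sum v); apply: memv_suml => k _.
have [kj | jk] := leqP k j; first by rewrite uv // scale0r mem0v.
by apply/memvZ/memv_span/map_f; rewrite mem_filter jk mem_enum.
Qed.

End Vectors.

(** * The group law [circ], the map of (i) and its quadratic inverse *)

Section DescendingMul.
Variables (n : nat) (m : vec n -> vec n -> vec n) (dm : descending m).
Implicit Types (x y v w : vec n) (i j k : 'I_n).

Let mA : associative m. Proof. by case: dm. Qed.
Let mC : commutative m. Proof. by case: dm. Qed.

Lemma dmulDr x y w : m x (y + w) = m x y + m x w.
Proof. by case: dm => -[ml _] _ _ _ _; have := ml x 1 y w; rewrite !scale1r. Qed.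

Lemma dmulDl x y w : m (x + y) w = m x w + m y w.
Proof. by rewrite mC dmulDr !(mC w). Qed.

Lemma dmulr0 x : m x 0 = 0.
Proof. by apply: (addrI (m x 0)); rewrite -dmulDr !addr0. Qed.

Lemma dmul0r x : m 0 x = 0.
Proof. by rewrite mC dmulr0. Qed.

Lemma dmulZr a x y : m x (a *: y) = a *: m x y.
Proof. by case: (F2_cases a) => ->; rewrite ?scale0r ?scale1r ?dmulr0. Qed.

Lemma dmulZl a x y : m (a *: x) y = a *: m x y.
Proof. by rewrite mC dmulZr mC. Qed.

Lemma dmul_sumr x (I : Type) (r : seq I) (P : pred I) (F : I -> vec n) :
  m x (\sum_(a <- r | P a) F a) = \sum_(a <- r | P a) m x (F a).
Proof. exact: (big_morph (m x) (dmulDr x) (dmulr0 x)). Qed.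

Lemma dmul_suml x (I : Type) (r : seq I) (P : pred I) (F : I -> vec n) :
  m (\sum_(a <- r | P a) F a) x = \sum_(a <- r | P a) m (F a) x.
Proof. by rewrite mC dmul_sumr; apply: eq_bigr => a _; rewrite mC. Qed.

(** In the square of [v + e i] the two cross terms cancel in characteristic 2. *)
Lemma dmulvv x : m x x = 0.
Proof.
elim/vec_ind: x => [|i v IH]; first exact: dmulr0.
case: dm => _ _ _ e0 _.
by rewrite dmulDl !dmulDr IH e0 addr0 add0r mC vecDD.
Qed.

Lemma dmul_ee_upper i j : upper j (m (e i) (e j)).
Proof.
have desc (a b : 'I_n) : (a < b)%N -> upper b (m (e a) (e b)).
  by move=> ab; case: dm => _ _ _ _ /(_ a b ab) /upper_span.
case: (ltngtP i j) => [/desc //|ji|/val_inj ->]; last by rewrite dmulvv; apply: upper0.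
by rewrite mC => k kj; apply: (desc _ _ ji); apply: leq_trans kj (ltnW ji).
Qed.

(** The terms of the filtration are ideals: expand both factors in the basis, where [m (e a) (e b)]
    is even [upper b]. *)
Lemma dmul_upper (j : nat) x y : upper j y -> upper j (m x y).
Proof.
move=> uy; rewrite [x]vec_sum [y]vec_sum dmul_suml; apply: upper_sum => a _.
rewrite dmul_sumr; apply: upper_sum => b _; rewrite dmulZl dmulZr.
apply: upperZ; case: (leqP b j) => [bj|jb]; first by rewrite uy // scale0r; apply: upper0.
by apply: upperZ => k kj; apply: dmul_ee_upper; apply: leq_trans kj (ltnW jb).
Qed.

Definition circ x y := x + y + m x y.

Lemma circA : associative circ.
Proof.
move=> x y w; rewrite /circ !dmulDl !dmulDr mA -!addrA; do 2!congr (_ + _).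
by rewrite [RHS]addrCA; congr (_ + _); rewrite addrCA; congr (_ + _); rewrite addrCA.
Qed.

Lemma circC : commutative circ.
Proof. by move=> x y; rewrite /circ [x + y]addrC mC. Qed.

Lemma circ0v : left_id 0 circ.
Proof. by move=> x; rewrite /circ add0r dmul0r addr0. Qed.

Lemma circvv x : circ x x = 0.
Proof. by rewrite /circ vecDD dmulvv addr0. Qed.

Lemma circ_upper (j : nat) x y : upper j x -> upper j y -> upper j (circ x y).
Proof. by move=> ux uy; apply: upperD; [apply: upperD | apply: dmul_upper]. Qed.

HB.instance Definition _ := Monoid.isComLaw.Build (vec n) 0 circ circA circC circ0v.

(** The map of (i) as a product for [circ]; [sum_eprod] expands it into the sum over nonempty
    subsets. *)
Definition gate_fun v : vec n := \big[circ/0]_(i | v 0 i == 1) e i.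

(** Exponents of each [e i] add modulo 2, because [circ x x = 0]. *)
Lemma gate_funD v w : gate_fun (v + w) = circ (gate_fun v) (gate_fun w).
Proof.
rewrite /gate_fun !(big_mkcond (fun i => _ == _)) -big_split; apply: eq_bigr => i _ /=.
rewrite mxE; case: (F2_cases (v 0 i)) => ->; case: (F2_cases (w 0 i)) => ->;
  by rewrite ?addr0 ?add0r ?eqxx /= ?circvv ?circ0v // circC circ0v.
Qed.

Lemma gate_fun0 : gate_fun 0 = 0.
Proof. by rewrite /gate_fun big1 // => i; rewrite mxE. Qed.

Lemma gate_fun_e i : gate_fun (e i) = e i.
Proof.
by rewrite /gate_fun (big_pred1 i) // => j; rewrite eE /=; case: (j == i).
Qed.

(** All factors but [e i] are [upper i], hence so is their product and anything it is multiplied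
    with: the leading coordinate survives. *)
Lemma gate_fun_lead i v :
  (forall k, (k < i)%N -> v 0 k = 0) -> v 0 i = 1 -> gate_fun v 0 i = 1.
Proof.
move=> v0 vi; rewrite /gate_fun (bigD1 i) ?vi //=; set w := \big[_/_]_(_ | _) _.
have uw : upper i w.
  rewrite /w; elim/big_ind: _ => [||k /andP[/eqP vk ki]]; first exact: upper0.
    exact: circ_upper.
  apply: upper_e; case: (ltngtP i k) => // [/v0|/val_inj ik]; first by rewrite vk.
  by rewrite ik eqxx in ki.
by rewrite !mxE uw // (dmul_upper _ uw) // eqxx eqxx !addr0.
Qed.

Lemma gate_fun_upper (j : nat) v : upper j (gate_fun v) -> upper j v.
Proof.
move=> uf k; have [N] := ubnP (k : nat); elim: N k => // N IH k kN kj.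
case: (F2_cases (v 0 k)) => // vk; have := uf k kj; rewrite gate_fun_lead // => a ak.
by apply: IH; [apply: leq_trans ak _ | apply: leq_trans kj; apply: ltnW].
Qed.

(** A homomorphism with trivial kernel: [v + w] is sent to 0, which is [upper i] for every [i], and
    [gate_fun_upper] pulls this back. *)
Lemma gate_fun_inj : injective gate_fun.
Proof.
move=> v w vw; apply/addv_eq0/rowP => i; rewrite [RHS]mxE.
by apply: (@gate_fun_upper i) => //; rewrite gate_funD vw circvv; apply: upper0.
Qed.

Definition gate_inv : vec n -> vec n := invF gate_fun_inj.

Lemma gate_funK : cancel gate_fun gate_inv. Proof. exact: invF_f. Qed.
Lemma gate_invK : cancel gate_inv gate_fun. Proof. exact: f_invF. Qed.

(** After applying [gate_fun] this is [circ (circ x y) (m x y) = x + y], where all products with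
    [m x y] contain a square and vanish. *)
Lemma gate_invD x y : gate_inv (x + y) = gate_inv x + gate_inv y + gate_inv (m x y).
Proof.
apply: gate_fun_inj; rewrite !gate_funD !gate_invK /circ dmulDl dmulDl dmulvv addr0.
by rewrite mA dmulvv dmul0r mC mA dmulvv dmul0r !addr0 vecDK.
Qed.

(** The correction term of [gate_invD] contains the square of [w]. *)
Lemma gate_inv_mulDl x y w : gate_inv (m (x + y) w) = gate_inv (m x w) + gate_inv (m y w).
Proof.
rewrite dmulDl gate_invD mA (mC _ y) mA -mA dmulvv dmulr0.
by rewrite -[0]gate_fun0 gate_funK addr0.
Qed.

Lemma gate_inv_mulDr x y w : gate_inv (m w (x + y)) = gate_inv (m w x) + gate_inv (m w y).
Proof. by rewrite mC gate_inv_mulDl !(mC w). Qed.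

Lemma gate_inv0 : gate_inv 0 = 0. Proof. by rewrite -{1}gate_fun0 gate_funK. Qed.

Lemma gate_invZ a x : gate_inv (a *: x) = a *: gate_inv x.
Proof. by case: (F2_cases a) => ->; rewrite ?scale0r ?scale1r ?gate_inv0. Qed.

Lemma gate_inv_e i : gate_inv (e i) = e i.
Proof. by rewrite -{1}gate_fun_e gate_funK. Qed.

(** Peel off the first summand with [gate_invD]. The correction is additive in the remaining sum, so
    nothing beyond pairs arises; sortedness lets each pair be listed once, as [i < j]. *)
Lemma gate_inv_sum (r : seq 'I_n) (F : 'I_n -> vec n) : sorted ltn (map val r) ->
  gate_inv (\sum_(i <- r) F i) = \sum_(i <- r) gate_inv (F i) +
    \sum_(i <- r) \sum_(j <- r | (i < j)%N) gate_inv (m (F i) (F j)).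
Proof.
elim: r => [|a r IH] srt; first by rewrite !big_nil gate_inv0 addr0.
have ar (b : 'I_n) : b \in r -> (a < b)%N.
  have /allP H := order_path_min ltn_trans srt.
  by move=> br; apply/H/map_f.
have lsum : gate_inv (m (F a) (\sum_(j <- r) F j)) = \sum_(j <- r) gate_inv (m (F a) (F j)).
  apply: (big_morph (fun x => gate_inv (m (F a) x))) => [x y|]; first exact: gate_inv_mulDr.
  by rewrite dmulr0 gate_inv0.
rewrite !big_cons ltnn gate_invD IH ?(path_sorted srt) // lsum -!addrA.
do 2!congr (_ + _); rewrite addrC; congr (_ + _).
  rewrite [RHS]big_seq_cond [LHS]big_seq; apply: eq_bigl => b.
  by case: (boolP (b \in r)) => //= /ar.
rewrite !big_seq; apply: eq_bigr => b br.
by rewrite big_cons ltnNge ltnW ?ar.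
Qed.

Lemma gate_inv_quadratic y :
  gate_inv y = y + \sum_(t : 'I_n * 'I_n * 'I_n |
      (t.1.1 < t.1.2 < t.2)%N && (gate_inv (m (e t.1.1) (e t.1.2)) 0 t.2 == 1))
    (y 0 t.1.1 * y 0 t.1.2) *: e t.2.
Proof.
rewrite [in LHS](vec_sum y) -big_enum gate_inv_sum; last first.
  by rewrite val_enum_ord iota_ltn_sorted.
congr (_ + _).
  rewrite big_enum [RHS]vec_sum; apply: eq_bigr => i _.
  by rewrite gate_invZ gate_inv_e.
rewrite big_enum -(pair_big_dep xpredT (fun (ij : 'I_n * 'I_n) k => (ij.1 < ij.2 < k)%N &&
   (gate_inv (m (e ij.1) (e ij.2)) 0 k == 1))
   (fun (ij : 'I_n * 'I_n) k => (y 0 ij.1 * y 0 ij.2) *: e k)) /=.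
rewrite -(pair_big xpredT xpredT (fun i j : 'I_n => \sum_(k : 'I_n | (i < j < k)%N &&
   (gate_inv (m (e i) (e j)) 0 k == 1)) (y 0 i * y 0 j) *: e k)) /=.
apply: eq_bigr => i _; rewrite big_enum_cond big_mkcond; apply: eq_bigr => j _ /=.
case: ltnP => _ /=; last by rewrite big_pred0.
rewrite dmulZl dmulZr !gate_invZ [in LHS](vec_sum (gate_inv _)) !scaler_sumr [RHS]big_mkcond.
apply: eq_bigr => k _.
(* Coefficients with [k <= j] vanish, since [gate_inv] keeps [m (e i) (e j)] in [upper j]; only
   staircase triples remain. *)
have [kj|jk] /= := leqP k j.
  rewrite (_ : gate_inv (m (e i) (e j)) 0 k = 0) ?scale0r ?scaler0 //.
  by apply: (@gate_fun_upper j) => //; rewrite gate_invK; apply: dmul_ee_upper.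
by case: (F2_cases (gate_inv (m (e i) (e j)) 0 k)) => ->;
  rewrite ?scale0r ?scaler0 ?scale1r ?scalerA.
Qed.
End DescendingMul.

(** * The sum over subsets in (i) *)

Section Eprod.
Variables (n : nat) (m : vec n -> vec n -> vec n) (dm : descending m).

Lemma enum_setU1_min (i : 'I_n) (T : {set 'I_n}) :
  (forall k, k \in T -> (i < k)%N) -> enum (i |: T) = i :: enum T.
Proof.
move=> iT; have srt (A : {set 'I_n}) : sorted (fun a b : 'I_n => (a < b)%N) (enum A).
  have -> : enum A = filter (mem A) (enum 'I_n) by rewrite enumT.
  apply: sorted_filter => [a b c|]; first exact: ltn_trans.
  by rewrite -(sorted_map (f := val) (e' := ltn)) val_enum_ord iota_ltn_sorted.
apply: (irr_sorted_eq (leT := fun a b : 'I_n => (a < b)%N)) => //.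
- by move=> a b c; apply: ltn_trans.
- by move=> a; apply: ltnn.
- rewrite /= path_min_sorted ?srt //; apply/allP => k; rewrite mem_enum; exact: iT.
by move=> k; rewrite mem_enum !inE mem_enum.
Qed.

(** Associativity pulls the first factor out of the left-nested product; the empty [T] is apart
    because there is no unit. *)
Lemma eprod_setU1_min (i : 'I_n) (T : {set 'I_n}) :
  (forall k, k \in T -> (i < k)%N) ->
  eprod m (i |: T) = if T == set0 then e i else m (e i) (eprod m T).
Proof.
move=> iT; rewrite /eprod enum_setU1_min //; case: eqVneq => [->|]; first by rewrite enum_set0.
rewrite -card_gt0 cardE; case: (enum T) => //= j s _.
elim: s (e j) => //= k s IH x; rewrite -IH; congr (foldl _ _ _).
by case: dm => _ mA _ _ _; rewrite mA.
Qed.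

(** Split off the smallest [i] in [S]. With [x] the sum for [S :\ i], subsets avoiding [i] give [x],
    the singleton gives [e i], and the others give [m (e i) x]: in total [circ (e i) x]. *)
Lemma sum_eprod (S : {set 'I_n}) :
  \sum_(T : {set 'I_n} | (T \subset S) && (T != set0)) eprod m T =
  gate_fun m (\sum_(i in S) e i).
Proof.
have [N] := ubnP #|S|; elim: N S => // N IH S SN.
case: (set_0Vmem S) => [->|[i0 i0S]].
  rewrite [in RHS]big_set0 (gate_fun0 dm) big_pred0 // => T.
  by rewrite subset0; case: eqP.
pose i := [arg min_(k < i0 in S) (k : nat)].
have [iS imin] : i \in S /\ forall k, k \in S -> (i <= k)%N.
  by rewrite /i; case: arg_minnP.
pose S' := S :\ i.
have S'E : S = i |: S' by rewrite setD1K.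
have iS' k : k \in S' -> (i < k)%N.
  by rewrite !inE => /andP[ki /imin]; rewrite leq_eqVlt eq_sym (inj_eq val_inj) (negPf ki).
have niS' : i \notin S' by rewrite !inE eqxx.
have {}IH : \sum_(T : {set 'I_n} | (T \subset S') && (T != set0)) eprod m T =
    gate_fun m (\sum_(k in S') e k).
  by apply: IH; rewrite S'E cardsU1 niS' in SN.
rewrite (big_setD1 i) //= -/S' (gate_funD dm) (gate_fun_e dm) -IH.
rewrite (bigID (fun T : {set 'I_n} => i \in T)) /=.
rewrite [X in _ + X](eq_bigl
  (fun T : {set 'I_n} => (T \subset S') && (T != set0))); last first.
  by move=> T; rewrite subsetD1 -!andbA; congr (_ && _); rewrite andbC.
rewrite (reindex_onto (fun T : {set 'I_n} => i |: T) (fun T => T :\ i)) /=; last first.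
  by move=> T /andP[_ iT]; rewrite setD1K.
rewrite (eq_bigl (fun T : {set 'I_n} => T \subset S')); last first.
  move=> T; rewrite subUset sub1set iS setU11 /= andbT subsetD1.
  rewrite -card_gt0 cardsU1 addn_gt0 -andbA; congr (_ && _).
  case: (boolP (i \in T)) => iT /=; last by rewrite setU1K ?eqxx.
  by apply/andP => -[_ /eqP E]; rewrite -E !inE eqxx in iT.
rewrite (bigD1 set0) ?sub0set //= eprod_setU1_min => [|k]; last by rewrite inE.
rewrite eqxx /circ (dmul_sumr dm) -addrA [X in _ + X = _]addrC -[RHS]addrA.
congr (_ + (_ + _)).
apply: eq_bigr => T /andP[/subsetP TS' /negPf T0].
by rewrite eprod_setU1_min ?T0 // => k /TS'/iS'.
Qed.
End Eprod.

(** * Toffoli circuits as maps on labels *)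

Section Runs.
Variable n : nat.
Implicit Types (t : 'I_n * 'I_n * 'I_n) (s : seq ('I_n * 'I_n * 'I_n)).
Implicit Types (v w : vec n) (i j k : 'I_n).

Definition step t v : vec n :=
  \row_l (if l == t.2 then v 0 t.2 + v 0 t.1.1 * v 0 t.1.2 else v 0 l).

Definition run s v := foldl (fun w t => step t w) v s.

Definition valid t := (t.1.1 < t.1.2 < t.2)%N.

Lemma stepE t v : step t v = v + (v 0 t.1.1 * v 0 t.1.2) *: e t.2.
Proof.
apply/rowP => l; rewrite !mxE eqxx /=.
by case: eqP => [->|_]; rewrite ?mulr1 ?mulr0 ?addr0.
Qed.

Lemma step_lt t v (l : 'I_n) : (l < t.2)%N -> step t v 0 l = v 0 l.
Proof. by move=> lt; rewrite mxE -val_eqE ltn_eqF. Qed.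

Lemma valid_lt t : valid t -> (t.1.1 < t.2)%N /\ (t.1.2 < t.2)%N.
Proof. by case/andP => ij jk; split=> //; apply: ltn_trans jk. Qed.

Lemma stepK t : valid t -> involutive (step t).
Proof.
case/valid_lt => ik jk v.
by rewrite [LHS]stepE !step_lt // stepE vecDK.
Qed.

Lemma run_inj s : all valid s -> injective (run s).
Proof.
elim: s => [|t s IH] /=; first by move=> _ v w.
by case/andP => vt /IH inj v w /inj /(can_inj (stepK vt)).
Qed.

(* A gate sees the final values of its controls, which no later gate targets;
   hence the input is a quadratic function of the output. *)
Lemma run_quadratic s v : all valid s ->
  sorted (fun t u : 'I_n * 'I_n * 'I_n => t.2 <= u.2)%N s ->
  v = run s v + \sum_(t <- s) (run s v 0 t.1.1 * run s v 0 t.1.2) *: e t.2.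
Proof.
elim: s v => [|t s IH] v /=; first by rewrite big_nil addr0.
case/andP => vt vs srt; rewrite big_cons.
have /IH {}IH : all valid s by [].
have {}IH := IH (step t v) (path_sorted srt).
have ts : all (fun u : 'I_n * 'I_n * 'I_n => t.2 <= u.2)%N s.
  apply: (order_path_min (leT := fun t u : 'I_n * 'I_n * 'I_n => (t.2 <= u.2)%N)) srt.
  by move=> a b c; apply: leq_trans.
have low (l : 'I_n) : (l < t.2)%N -> run s (step t v) 0 l = v 0 l.
  move=> lt; rewrite -(step_lt v lt) [in RHS]IH mxE big_seq summxE big1 ?addr0 // => u us.
  rewrite mxE eE (_ : (l == u.2) = false) ?mulr0 //.
  by rewrite -val_eqE ltn_eqF // (leq_trans lt) // (allP ts).
have [ik jk] := valid_lt vt.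
by rewrite addrCA -IH [X in _ + X]stepE !low // addrC vecDK.
Qed.

Lemma step_disjoint t v : v 0 t.1.1 * v 0 t.1.2 = 0 -> step t v = v.
Proof. by move=> v0; rewrite stepE v0 scale0r addr0. Qed.

Lemma run0 s : run s 0 = 0.
Proof. by elim: s => //= t s IH; rewrite step_disjoint ?mxE ?mul0r. Qed.

Lemma run_e s i : all valid s -> run s (e i) = e i.
Proof.
elim: s => //= t s IH /andP[vt vs]; rewrite step_disjoint ?IH // !eE.
case/andP: vt => ij _; case: eqP => [ti|]; last by rewrite mul0r.
by rewrite -ti (_ : (t.1.2 == t.1.1) = false) ?mulr0 // -val_eqE gtn_eqF.
Qed.

(** The general [w] is the loop invariant. A gate whose second control is at least [j] targets above
    [j]; otherwise both controls lie below [j], where only coordinate [i] is set, so the gate does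
    not fire. *)
Lemma run_ee s i j w : all valid s -> (i < j)%N -> upper j w ->
  exists2 w', upper j w' & run s (e i + e j + w) = e i + e j + w'.
Proof.
move=> vs ij; elim: s w vs => [|t s IH] w /=; first by exists w.
case/andP => vt vs uw; rewrite stepE -addrA; apply: IH => //; apply: upperD => //.
have [tj|jt] := leqP t.1.2 j; last first.
  apply/upperZ/upper_e; case/valid_lt: vt => _; exact: ltn_trans.
case/andP: vt => t12 t23.
have [tj'|] := eqVneq t.1.2 j; first by apply/upperZ/upper_e; rewrite -tj'.
rewrite -val_eqE => tj'; have {tj tj'} tj : (t.1.2 < j)%N by rewrite ltn_neqAle tj'.
set c := _ * _; rewrite (_ : c = 0) ?scale0r; first exact: upper0.
rewrite /c [(e i + _ + w) 0 _]mxE [(e i + _) 0 _]mxE !eE uw ?(ltnW (ltn_trans t12 tj)) //.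
rewrite [(e i + _ + w) 0 _]mxE [(e i + _) 0 _]mxE !eE uw ?(ltnW tj) //.
rewrite !addr0 -!val_eqE (ltn_eqF tj) (ltn_eqF (ltn_trans t12 tj)) !addr0.
have [ti|_] := eqVneq (val t.1.1) (val i); last by rewrite mul0r.
by rewrite -ti gtn_eqF ?mulr0.
Qed.

(** Staircase form asks for distinct gates, whereas [toffoli_seq] provides distinct triples. *)
Lemma step_inj t u : valid t -> valid u -> step t =1 step u -> t = u.
Proof.
move=> vt vu tu.
have [/andP[t12 t23] /andP[u12 u23]] := (vt, vu).
(* Only the controls of [t] are set, so [t] fires; [u] must fire too, with its controls among these
   two and with the same target. *)
set v := e t.1.1 + e t.1.2 : vec n.
have vE l : v 0 l = ((l == t.1.1) || (l == t.1.2))%:R.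
  rewrite mxE !eE; case: eqP => [->|_] /=; last by rewrite add0r.
  by rewrite -val_eqE (ltn_eqF t12) addr0.
have := tu v; rewrite !stepE => /addrI; rewrite !vE !eqxx orbT mulr1 scale1r.
case: (boolP (_ || _)) => [u1|_]; last first.
  by rewrite mul0r scale0r => /rowP/(_ t.2); rewrite !mxE !eqxx.
case: (boolP (_ || _)) => [u2|_]; last first.
  by rewrite mulr0 scale0r => /rowP/(_ t.2); rewrite !mxE !eqxx.
rewrite mulr1 scale1r => /rowP/(_ t.2); rewrite !eE eqxx.
case: eqP => // t3 _.
case: t u {vt vu tu v vE} t12 t23 u12 u23 u1 u2 t3 => [[t1 t2] t3] [[u1 u2] u3] /= t12 _ u12 _.
by do 2!case/orP => /eqP ?; move=> ?; subst => //;
  move: t12 u12; rewrite ?ltnn // ltnNge => /negP + /ltnW.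
Qed.
End Runs.

Arguments valid {n} t.

(** * Recovering the multiplication from a gate *)

Section ExtractMul.
Variables (n : nat) (f : vec n -> vec n).
Hypotheses (f_inj : injective f) (f0 : f 0 = 0) (fe : forall i, f (e i) = e i).
Hypothesis fee : forall i j : 'I_n, (i < j)%N ->
  exists2 w, upper j w & f (e i + e j) = e i + e j + w.
(** Membership in C_3 provides this, by [clifford3_affine]; the hypotheses above come from the
    staircase form. *)
Hypothesis faff : forall u, exists g : vec n -> vec n,
  (forall v, f (v + u) = g (f v)) /\ (forall x y, g (x + y) + g 0 = g x + g y).

(** The bilinear extension of [f |e_i + e_j> = |e_i + e_j + e_i e_j>]. *)
Definition ee_mul (x y : vec n) : vec n :=
  \sum_i \sum_j (x 0 i * y 0 j) *: (e i + e j + f (e i + e j)).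

Lemma ee_mulC : commutative ee_mul.
Proof.
move=> x y; rewrite /ee_mul exchange_big; apply: eq_bigr => i _; apply: eq_bigr => j _.
by rewrite mulrC [e j + e i]addrC.
Qed.

Lemma ee_mulDr x : {morph ee_mul x : y w / y + w}.
Proof.
move=> y w; rewrite /ee_mul -big_split; apply: eq_bigr => i _ /=.
by rewrite -big_split; apply: eq_bigr => j _ /=; rewrite mxE mulrDr scalerDl.
Qed.

Lemma ee_mulDl y : {morph ee_mul^~ y : x w / x + w}.
Proof. by move=> x w /=; rewrite !(ee_mulC _ y) ee_mulDr. Qed.

Lemma ee_mul_bilinear : bilinear_op ee_mul.
Proof.
have lin x : linear (ee_mul x).
  move=> a y w; rewrite ee_mulDr; congr (_ + _).
  rewrite /ee_mul scaler_sumr; apply: eq_bigr => i _.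
  by rewrite scaler_sumr; apply: eq_bigr => j _; rewrite mxE mulrCA scalerA.
by split=> // y a x w; rewrite !(ee_mulC _ y) lin.
Qed.

Lemma ee_mul_e i j : ee_mul (e i) (e j) = e i + e j + f (e i + e j).
Proof.
rewrite /ee_mul (bigD1 i) //= [X in _ + X]big1 ?addr0 => [|k ki].
  rewrite (bigD1 j) //= big1 ?addr0 => [|k kj]; first by rewrite !eE !eqxx mulr1 scale1r.
  by rewrite [e j _ _]eE (negPf kj) mulr0 scale0r.
by rewrite big1 // => l _; rewrite eE (negPf ki) mul0r scale0r.
Qed.

(** As [g] is affine with [g 0 = e i], the map [x |-> g x + e i + x] is additive, and on each [e j]
    it is the product with [e i] by definition. *)
Lemma f_step i v : f (v + e i) = e i + f v + ee_mul (e i) (f v).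
Proof.
have [g [fg gaff]] := faff (e i).
have g0 : g 0 = e i by rewrite -f0 -fg add0r fe.
suff h : forall x, g x + e i + x = ee_mul (e i) x.
  by rewrite fg -h [RHS]addrC -(addrA (g _)) vecDK.
apply: (additive_ext (g := fun x => g x + e i + x)) => [x y||j]; last 1 first.
- by rewrite -{1}[e j]fe -fg ee_mul_e [e j + e i]addrC -addrA addrC.
- rewrite -[g (x + y)](vecDK _ (g 0)) gaff g0 vecDK.
  by rewrite [RHS]addrACA (addrACA (g x) (e i)) vecDD addr0.
exact: ee_mulDr.
Qed.

Lemma ee_mulCA : forall x y w, ee_mul x (ee_mul y w) = ee_mul y (ee_mul x w).
Proof.
move=> x y w.
apply: (additive_ext (g := fun x => ee_mul x (ee_mul y w))
  (h := fun x => ee_mul y (ee_mul x w))).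
- by move=> a b; rewrite ee_mulDl.
- by move=> a b; rewrite ee_mulDl ee_mulDr.
move=> i.
apply: (additive_ext (g := fun y => ee_mul (e i) (ee_mul y w))
  (h := fun y => ee_mul y (ee_mul (e i) w))).
- by move=> a b; rewrite ee_mulDl ee_mulDr.
- by move=> a b; rewrite ee_mulDl.
(* Being injective on a finite set, [f] is onto, so [w] may be taken as [f v]. The two expansions of
   [f (v + e i + e j)] share all summands but the triple products. *)
move=> j; have [finv _ fK] := injF_bij f_inj; rewrite -(fK w); move: (finv w) => v {x y w}.
have := f_step i (v + e j); rewrite addrAC f_step f_step f_step !ee_mulDr.
rewrite [ee_mul (e j) (e i)]ee_mulC.
rewrite !addrA [LHS](ACl (2*1*3*5*4*6*7)) [RHS](ACl (1*2*3*5*6*4*7)) /=.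
by move/addrI.
Qed.

Lemma ee_mul_descending : descending ee_mul.
Proof.
split.
- exact: ee_mul_bilinear.
- by move=> x y w; rewrite (ee_mulC y) ee_mulCA ee_mulC.
- exact: ee_mulC.
- by move=> i; rewrite ee_mul_e vecDD f0 addr0.
move=> i j ij; apply/upper_span; rewrite ee_mul_e.
by have [w uw ->] := fee ij; rewrite addrA vecDD add0r.
Qed.

(** Adding [e i] to the argument acts on both sides as [circ] with [e i]. *)
Lemma gate_fun_ee_mul : gate_fun ee_mul =1 f.
Proof.
elim/vec_ind => [|i v IH]; first by rewrite f0 (gate_fun0 ee_mul_descending).
rewrite (gate_funD ee_mul_descending) (gate_fun_e ee_mul_descending) IH f_step /circ.
by rewrite [f v + _]addrC ee_mulC.
Qed.

End ExtractMul.

(** * The staircase circuit of a descending multiplication *)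

Section StaircaseForm.
Variables (n : nat) (m : vec n -> vec n -> vec n) (dm : descending m).

Definition toffoli_seq : seq ('I_n * 'I_n * 'I_n) :=
  sort (fun t u : 'I_n * 'I_n * 'I_n => (t.2 <= u.2)%N)
    (enum [pred t : 'I_n * 'I_n * 'I_n |
      valid t & gate_inv dm (m (e t.1.1) (e t.1.2)) 0 t.2 == 1]).

Lemma toffoli_seq_sorted :
  sorted (fun t u : 'I_n * 'I_n * 'I_n => (t.2 <= u.2)%N) toffoli_seq.
Proof. by apply: sort_sorted => t u; apply: leq_total. Qed.

Lemma toffoli_seq_valid : all valid toffoli_seq.
Proof. by rewrite all_sort; apply/allP => t; rewrite mem_enum => /andP[]. Qed.

Lemma toffoli_seq_uniq : uniq toffoli_seq.
Proof. by rewrite sort_uniq enum_uniq. Qed.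

(** [run_quadratic] writes the input in terms of the output by the same quadratic formula that
    [gate_inv_quadratic] gives for [gate_inv]. *)
Lemma run_toffoli_seq : run toffoli_seq =1 gate_fun m.
Proof.
move=> v; apply: (can_inj (gate_invK dm)); rewrite gate_funK.
rewrite {2}(run_quadratic v toffoli_seq_valid toffoli_seq_sorted).
by rewrite gate_inv_quadratic (perm_big _ (permEl (perm_sort _ _))) big_enum.
Qed.
End StaircaseForm.

Local Open Scope sesquilinear_scope.

(** * Monomial operators, Pauli operators and the Clifford hierarchy *)

Section Matrices.
Variables (C : numClosedFieldType) (n : nat).
Implicit Types (U V : operator C n) (f g : vec n -> vec n) (c d : vec n -> C).
Implicit Types (v w x y z : vec n).

(** The operator sending [ket v] to [c v *: ket (f v)]. *)
Definition mono c f : operator C n :=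
  \matrix_(a, b) (c (label b) *+ (label a == f (label b))).

Definition pmx f := mono (fun=> 1) f.

Lemma gate_ext U V : (forall v, U *m ket C v = V *m ket C v) -> U = V.
Proof.
move=> UV; apply/matrixP => a b; have := UV (label b).
by rewrite /ket /label enum_valK -!colE => /colP/(_ a); rewrite !mxE.
Qed.

Lemma mono_ket c f v : mono c f *m ket C v = c v *: ket C (f v).
Proof.
rewrite /ket -colE; apply/colP => a; rewrite !mxE eqxx andbT /label enum_rankK.
by rewrite -(can_eq enum_valK) enum_rankK mulr_natr.
Qed.

Lemma eq_mono c d f g : c =1 d -> f =1 g -> mono c f = mono d g.
Proof. by move=> cd fg; apply/matrixP => a b; rewrite !mxE cd fg. Qed.

Lemma mono_mul c f d g :
  mono c f *m mono d g = mono (fun v => d v * c (g v)) (f \o g).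
Proof.
by apply: gate_ext => v; rewrite -mulmxA !mono_ket -scalemxAr mono_ket scalerA.
Qed.

Lemma mono_id : mono (fun=> 1) id = 1%:M.
Proof. by apply: gate_ext => v; rewrite mono_ket mul1mx scale1r. Qed.

Lemma mono_adj c f g : cancel f g -> cancel g f ->
  (mono c f)^t* = mono (fun v => (c (g v))^*) g.
Proof.
move=> fK gK; apply/matrixP => a b; rewrite !mxE rmorphMn.
rewrite (eq_sym (label b)) (can2_eq fK gK).
by case: eqP => [->|_].
Qed.

Lemma mono_inj c d f g : (forall v, c v != 0) -> mono c f = mono d g -> f =1 g.
Proof.
move=> c0 E v; have := congr1 (mulmx^~ (ket C v)) E; rewrite /= !mono_ket.
move=> /colP/(_ (enum_rank (f v))); rewrite !mxE !eqxx !andbT mulr1.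
case: eqP => [/enum_rank_inj //|_ cv]; first by move: (c0 v); rewrite cv mulr0 eqxx.
Qed.

Lemma pmx_inj f g : pmx f = pmx g -> f =1 g.
Proof. by apply: mono_inj => v; apply: oner_neq0. Qed.

Lemma mono_unitary c f g : cancel f g -> cancel g f ->
  (forall v, c v * (c v)^* = 1) -> mono c f \is unitarymx.
Proof.
move=> fK gK c1; apply/unitarymxP; rewrite (mono_adj _ fK gK) mono_mul -mono_id.
by apply: eq_mono => v /=; rewrite ?gK // mulrC c1.
Qed.

Lemma pmx_permutation_gate f : injective f -> permutation_gate (pmx f).
Proof.
move=> fI; have [g fK gK] := injF_bij fI; split.
  by apply: mono_unitary fK gK _ => v; rewrite mul1r conjC1.
(* A permutation matrix of [s] has the 1 of row [a] in column [s a], hence the inverse [g] here. *)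
have hI : injective (fun a : 'I_#|{: vec n}| => enum_rank (g (label a))).
  by move=> a b /enum_rank_inj /(can_inj gK) /enum_val_inj.
apply/is_perm_mxP; exists (perm.perm hI); apply/matrixP => a b.
rewrite !mxE perm.permE (can2_eq (@enum_rankK _) (@enum_valK _)) eq_sym.
by rewrite (can2_eq fK gK) eq_sym.
Qed.

Lemma tof_pmx t : tof C t = pmx (step t).
Proof. by apply/matrixP => a b; rewrite !mxE. Qed.

Lemma circuit_pmx s : circuit C s = pmx (run s).
Proof.
rewrite /circuit -mono_id.
suff H f : foldl (fun U t => tof C t *m U) (pmx f) s = pmx (run s \o f).
  by rewrite H.
elim: s f => //= t s IH f.
rewrite tof_pmx mono_mul -IH; congr (foldl _ _ s).
by apply: eq_mono => // v; rewrite mulr1.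
Qed.

Definition sgn (a : 'F_2) : C := (-1) ^+ a.

Lemma sgnD : {morph sgn : a b / a + b >-> a * b}.
Proof.
move=> a b; case: (F2_cases a) => ->; first by rewrite add0r /sgn mul1r.
case: (F2_cases b) => ->; first by rewrite addr0 /sgn mulr1.
by rewrite (_ : 1 + 1 = 0) ?/sgn ?mulrNN ?mul1r //; apply: val_inj.
Qed.

Lemma sgn0 : sgn 0 = 1. Proof. by []. Qed.

Lemma sgn_sqr a : sgn a * sgn a = 1.
Proof. by rewrite -expr2 sqrr_sign. Qed.

Lemma sgn_conj a : (sgn a)^* = sgn a.
Proof. by rewrite rmorphXn rmorphN1. Qed.

Definition pauli1 (a b : 'F_2) : 'M[C]_2 :=
  if a == 0 then (if b == 0 then 1%:M else pauliZ C)
  else (if b == 0 then pauliX C else pauliY C).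

(** [pauli1 a b] is X^a Z^b up to this factor, since Y = iXZ. *)
Definition pauli1_phase (a b : 'F_2) : C := if (a == 1) && (b == 1) then 'i else 1.

Lemma pauli1E (a b i j : 'F_2) :
  pauli1 a b i j = (pauli1_phase a b * sgn (b * j)) *+ (i == j + a).
Proof.
by case: (F2_cases a) => ->; case: (F2_cases b) => ->; case: (F2_cases i) => ->;
  case: (F2_cases j) => ->; rewrite /pauli1 /= !mxE /pauli1_phase /sgn /=
    ?expr0 ?expr1 ?mulr1 ?mulrN1.
Qed.

Lemma pauli1_surj P : P \in [:: 1%:M; pauliX C; pauliY C; pauliZ C] ->
  exists ab : 'F_2 * 'F_2, P = pauli1 ab.1 ab.2.
Proof.
by rewrite !inE => /or4P[] /eqP->; [exists (0, 0)|exists (1, 0)|exists (1, 1)|exists (0, 1)].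
Qed.

Lemma pauli1_in (a b : 'F_2) : pauli1 a b \in [:: 1%:M; pauliX C; pauliY C; pauliZ C].
Proof. by rewrite /pauli1; case: ifP; case: ifP; rewrite !inE eqxx ?orbT. Qed.

Lemma unit4P (a : C) : (a \in [:: 1; -1; 'i; - 'i]) = (a ^+ 4 == 1).
Proof.
rewrite !inE (exprM a 2 2) -[1 in RHS](expr1n _ 2) eqf_sqr -{1}[1 in RHS](expr1n _ 2) eqf_sqr.
by rewrite -(sqrCi C) eqf_sqr orbA.
Qed.

Lemma pauli1_phase4 a b : pauli1_phase a b ^+ 4 = 1.
Proof.
rewrite /pauli1_phase; case: ifP => _; last exact: expr1n.
by rewrite (exprM _ 2 2) sqrCi sqrrN expr1n.
Qed.

Definition dot z v : 'F_2 := \sum_j z 0 j * v 0 j.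

Lemma dotD z : {morph dot z : v w / v + w}.
Proof. by move=> v w; rewrite -big_split; apply: eq_bigr => j _; rewrite mxE mulrDr. Qed.

Lemma tensor_pauli1 x z : tensor (fun j => pauli1 (x 0 j) (z 0 j)) =
  mono (fun v => (\prod_j pauli1_phase (x 0 j) (z 0 j)) * sgn (dot z v)) (fun v => v + x).
Proof.
apply/matrixP => a b; rewrite !mxE (big_morph sgn sgnD sgn0) -big_split /=.
case: eqP => [->|/eqP ne]; first by apply: eq_bigr => j _; rewrite pauli1E mxE eqxx.
have [j nej] : exists j, label a 0 j != (label b + x) 0 j.
  apply/existsP; apply: contraNT ne => /existsPn E.
  by apply/eqP/rowP => j; apply/eqP; rewrite -[_ == _]negbK.
by rewrite (bigD1 j) //= pauli1E; move: nej; rewrite mxE => /negPf ->; rewrite mul0r.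
Qed.

(** Paulis are translations with a character as phase, up to a fourth root of unity; [mono_pauli] is
    the converse. *)
Lemma pauli_monoP U : pauli_group U ->
  exists a x z, a ^+ 4 = 1 /\ U = mono (fun v => a * sgn (dot z v)) (fun v => v + x).
Proof.
case=> a [P [a4 Pin ->]].
have [ab Pab] := fin_all_exists (fun j => pauli1_surj (Pin j)).
pose x := \row_j (ab j).1; pose z := \row_j (ab j).2.
have -> : tensor P = tensor (fun j => pauli1 (x 0 j) (z 0 j)).
  by apply/matrixP => i j; rewrite !mxE; apply: eq_bigr => k _; rewrite Pab !mxE.
exists (a * \prod_j pauli1_phase (x 0 j) (z 0 j)), x, z; split.
  rewrite exprMn -prodrXl (eqP (etrans (esym (unit4P _)) a4)) mul1r.
  by rewrite big1 // => j _; apply: pauli1_phase4.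
rewrite tensor_pauli1; apply/matrixP => i j.
by rewrite !mxE mulrnAr mulrA.
Qed.

Lemma mono_pauli a x (l : vec n -> 'F_2) : a ^+ 4 = 1 -> {morph l : v w / v + w} ->
  pauli_group (mono (fun v => a * sgn (l v)) (fun v => v + x)).
Proof.
move=> a4 lD; pose z : vec n := \row_j l (e j).
have lz : l =1 dot z.
  apply: additive_ext => // [|i]; first exact: dotD.
  rewrite /dot (bigD1 i) //= big1 ?addr0 => [|j ji]; first by rewrite eE eqxx mulr1 mxE.
  by rewrite eE (negPf ji) mulr0.
(* The phase contributed by the Y factors, divided out of the scalar below. *)
pose p := \prod_j pauli1_phase (x 0 j) (z 0 j).
have p4 : p ^+ 4 = 1 by rewrite -prodrXl big1 // => j _; apply: pauli1_phase4.
have p0 : p != 0.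
  by apply: contra_eq_neq p4 => ->; rewrite expr0n eq_sym oner_neq0.
exists (a / p), (fun j => pauli1 (x 0 j) (z 0 j)); split.
- by rewrite unit4P exprMn exprVn a4 p4 divr1.
- by move=> j; apply: pauli1_in.
rewrite tensor_pauli1; apply/matrixP => i j.
by rewrite !mxE mulrnAr -/p mulrA divfK // lz.
Qed.

Lemma pmx_pauli x : pauli_group (pmx (fun v => v + x)).
Proof.
have -> : pmx (fun v => v + x) = mono (fun v => 1 * sgn 0) (fun v => v + x).
  by apply: eq_mono => // v; rewrite mulr1.
by apply: (@mono_pauli 1 x (fun=> 0)) => [|v w]; rewrite ?expr1n ?addr0.
Qed.

Lemma unit4_conj (a : C) : a ^+ 4 = 1 -> a * a^* = 1.
Proof.
move=> a4; rewrite -normCK; have /eqP := congr1 Num.norm a4.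
rewrite normrX normr1 => h; have : `|a| == 1 by rewrite -(pexpr_eq1 (n := 4)).
by move/eqP ->; rewrite expr1n.
Qed.

(** An affine permutation with a quadratic phase: the last hypothesis says that the derivatives of
    [q] are affine. Conjugating a Pauli with translation part [x] gives translation by [f x + f 0]
    with an affine phase. *)
Lemma clifford2_mono (a : C) (q : vec n -> 'F_2) f g : a ^+ 4 = 1 ->
  cancel f g -> cancel g f ->
  (forall v w, f (v + w) = f v + f w + f 0) ->
  (forall x, exists (l : vec n -> 'F_2) (k : 'F_2), {morph l : v w / v + w} /\
     forall v, q v + q (v + x) = l v + k) ->
  clifford 2 (mono (fun v => a * sgn (q v)) f).
Proof.
move=> a4 fK gK faff qquad.
have a1 v : a * sgn (q v) * (a * sgn (q v))^* = 1.
  by rewrite rmorphM /= sgn_conj mulrACA sgn_sqr unit4_conj ?mulr1.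
split; first exact: mono_unitary fK gK a1.
move=> P /pauli_monoP[d [x [z [d4 ->]]]].
rewrite (mono_adj _ fK gK) !mono_mul.
have [l [k [lD lE]]] := qquad x.
(* [h] is the linear part of [g]; the constants [k] and [t (g 0)] go into the scalar. *)
pose h y := g y + g 0; pose t y := l y + dot z y.
have tD : {morph t : v w / v + w}.
  by move=> v w; rewrite /t lD dotD addrACA.
have hD : {morph h : v w / v + w}.
  move=> v w; rewrite /h; apply: (can_inj fK); rewrite !faff !gK.
  by rewrite !addr0 (addrACA v) vecDD addr0.
rewrite (eq_mono (d := fun y => (d * sgn (k + t (g 0))) * sgn (t (h y)))
  (g := fun y => y + (f x + f 0))).
- apply: mono_pauli => [|v w]; last by rewrite hD tD.
  by rewrite exprMn d4 mul1r (exprM _ 2 2) sqrr_sign expr1n.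
- move=> y /=; rewrite rmorphM /= sgn_conj.
  have -> : a^* * sgn (q (g y)) * (d * sgn (dot z (g y)) * (a * sgn (q (g y + x)))) =
    (a * a^*) * d * (sgn (q (g y)) * sgn (q (g y + x)) * sgn (dot z (g y))).
    by rewrite !mulrA [LHS](ACl (5 * 1 * 3 * 2 * 6 * 4)).
  rewrite unit4_conj // mul1r -!sgnD lE -mulrA -sgnD; congr (_ * sgn _).
  rewrite tD [RHS]addrACA (_ : t (g 0) + t (g 0) = 0) ?addr0 => [|].
    by rewrite addrAC addrC.
  by case: (F2_cases (t (g 0))) => ->; apply: val_inj.
by move=> y /=; rewrite faff gK addrA.
Qed.

(** Unfold the hierarchy twice on translations. The conjugate [g] of translation by [u] is in C_2,
    so it conjugates translation by [w] to a Pauli, which moves labels by some [b]; thus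
    [g (v + w) = g v + b]. *)
Lemma clifford3_affine f : injective f -> clifford 3 (pmx f) ->
  forall u, exists g : vec n -> vec n,
    (forall v, f (v + u) = g (f v)) /\ (forall x y, g (x + y) + g 0 = g x + g y).
Proof.
move=> fI [_ f3] u; have [fi fK fiK] := injF_bij fI.
pose g y := f (fi y + u); exists g; split=> [v|]; first by rewrite /g fK.
have gK : involutive g by move=> y; rewrite /g fK vecDK fiK.
have VE : pmx f *m pmx (fun v => v + u) *m (pmx f)^t* = pmx g.
  rewrite (mono_adj _ fK fiK) !mono_mul; apply: eq_mono => // v.
  by rewrite conjC1 !mulr1.
have := f3 _ (pmx_pauli u); rewrite VE => -[_ g2].
have gb w : exists b, forall y, g (g y + w) = y + b.
  have := g2 _ (pmx_pauli w); rewrite (mono_adj _ gK gK) !mono_mul.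
  case/pauli_monoP => a [b [z [a4 E]]]; exists b; apply: mono_inj E => v /=.
  by rewrite conjC1 !mulr1 oner_neq0.
move=> x y; have [b gE] := gb y.
have gw v : g (v + y) = g v + b by rewrite -{1}[v]gK gE.
have := gw 0; rewrite add0r gw => ->; rewrite addrA addrAC.
by rewrite -!addrA; do !congr (_ + _); rewrite addrC.
Qed.

End Matrices.

(** * The two maps and their uniqueness *)

Section Correspondence.
Variables (C : numClosedFieldType) (n : nat).
Implicit Types (U : operator C n) (m : vec n -> vec n -> vec n).

Lemma gate_of_mulP m U : descending m -> gate_of_mul m U <-> U = pmx C (gate_fun m).
Proof.
move=> dm; split=> [gU | -> S]; last by rewrite mono_ket scale1r sum_eprod.
apply: gate_ext => v; have -> : v = \sum_(i in [set i | v 0 i == 1]) e i.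
  rewrite [LHS]vec_sum [RHS]big_mkcond; apply: eq_bigr => i _; rewrite inE.
  by case: (F2_cases (v 0 i)) => ->; rewrite ?scale0r ?scale1r.
by rewrite gU mono_ket scale1r sum_eprod.
Qed.

Lemma staircase_gate_fun m : descending m -> staircase (pmx C (gate_fun m)).
Proof.
move=> dm; split; first exact/pmx_permutation_gate/(gate_fun_inj dm).
exists (toffoli_seq dm); split.
- exact: toffoli_seq_valid.
- rewrite map_inj_in_uniq ?toffoli_seq_uniq // => t u tS uS.
  have /allP V := toffoli_seq_valid dm.
  by rewrite !tof_pmx => /pmx_inj; apply: step_inj; apply: V.
- exact: toffoli_seq_sorted.
by rewrite circuit_pmx; apply: eq_mono => // v; rewrite run_toffoli_seq.
Qed.

Lemma clifford3_gate_fun m : descending m -> clifford 3 (pmx C (gate_fun m)).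
Proof.
move=> dm; have fK := gate_funK dm; have gK := gate_invK dm.
have [_ mA mC _ _] := dm.
split; first by case: (pmx_permutation_gate C (gate_fun_inj dm)).
move=> P /pauli_monoP[a [x [z [a4 ->]]]].
rewrite (mono_adj _ fK gK) !mono_mul.
(* The conjugate of translation by [x]: an involution because [circ] has exponent 2, and affine
   because [m] is bilinear. *)
pose f y := circ m y (gate_fun m x).
have ff : involutive f by move=> y; rewrite /f -circA // circvv // circC // circ0v.
rewrite (eq_mono (d := fun y => a * sgn C (dot z (gate_inv dm y))) (g := f)).
- apply: (clifford2_mono _ (ff) (ff)) => // [v w|w].
    rewrite /f /circ add0r (dmul0r dm) (dmulDl dm) addr0.
    by rewrite (addrACA (v + gate_fun m x)) (addrACA v (gate_fun m x)) vecDD addr0 [RHS]addrAC.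
  (* By [gate_invD] these are the linear and the constant part of the derivative of the phase in
     direction [w]. *)
  exists (fun v => dot z (gate_inv dm (m v w))), (dot z (gate_inv dm w)); split.
    by move=> u v; rewrite gate_inv_mulDl dotD.
  move=> v; rewrite -!dotD gate_invD // -(addrA (gate_inv dm v)).
  by rewrite (addrA (gate_inv dm v) (gate_inv dm v)) vecDD add0r addrC.
- by move=> y /=; rewrite conjC1 mul1r mulr1.
by move=> y /=; rewrite (gate_funD dm) gK.
Qed.

Lemma mul_of_gate_gate_fun m : descending m -> mul_of_gate (pmx C (gate_fun m)) m.
Proof.
move=> dm; split=> [|i j]; first by case: dm.
by rewrite mono_ket scale1r (gate_funD dm) !(gate_fun_e dm).
Qed.

Lemma mul_of_gate_uniq U m m' : mul_of_gate U m -> mul_of_gate U m' -> m = m'.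
Proof.
have addr_lin (g : vec n -> vec n) : linear g -> {morph g : x y / x + y}.
  by move=> gl x y; have := gl 1 x y; rewrite !scale1r.
move=> [[mr ml] mU] [[mr' ml'] mU']; apply/funext => x; apply/funext => y.
move: x; apply: additive_ext; [exact/addr_lin/ml|exact/addr_lin/ml'|move=> i].
move: y; apply: additive_ext; [exact/addr_lin/mr|exact/addr_lin/mr'|move=> j].
have := mU i j; rewrite mU' => /colP/(_ (enum_rank (e i + e j + m (e i) (e j)))).
rewrite !mxE !eqxx !andbT; case: eqP => [/enum_rank_inj /addrI -> //|_ /eqP].
by rewrite eq_sym oner_eq0.
Qed.

Lemma staircase_mul U : staircase U -> clifford 3 U ->
  exists2 m, descending m & U = pmx C (gate_fun m).
Proof.
case=> _ [s [vs _ _ ->]]; rewrite circuit_pmx => U3.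
have inj := run_inj vs; have aff := clifford3_affine inj U3.
have f0 := run0 s; have fe i := run_e i vs.
have fee (i j : 'I_n) : (i < j)%N ->
    exists2 w, upper j w & run s (e i + e j) = e i + e j + w.
  by move=> ij; have := run_ee vs ij (@upper0 n j); rewrite addr0.
exists (ee_mul (run s)); first exact: ee_mul_descending.
by apply: eq_mono => // v; rewrite gate_fun_ee_mul.
Qed.
End Correspondence.

Theorem theorem4p2 (R : realType) (n : nat) (hn : (0 < n)%N) :
  exists (Phi : descending_mul n -> staircase_C3 R[i] n)
         (Psi : staircase_C3 R[i] n -> descending_mul n),
    [/\ forall (m : descending_mul n) (U : operator R[i] n),
          gate_of_mul (sval m) U <-> U = sval (Phi m),
        forall (U : staircase_C3 R[i] n) (m : vec n -> vec n -> vec n),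
          mul_of_gate (sval U) m <-> m = sval (Psi U),
        cancel Phi Psi
      & cancel Psi Phi].
Proof.
pose C : numClosedFieldType := R[i].
have sval_inj (T : Type) (P : T -> Prop) (u v : {x | P x}) : sval u = sval v -> u = v.
  by case: u v => [u pu] [v pv] /= uv; apply: eq_exist.
pose Phi (m : descending_mul n) : staircase_C3 C n :=
  exist _ (pmx C (gate_fun (sval m)))
    (conj (staircase_gate_fun C (svalP m)) (clifford3_gate_fun C (svalP m))).
(* [Phi] is onto, and [Psi] picks a preimage by choice, so it is a right inverse by construction;
   uniqueness of the extracted product makes it a left inverse too. *)
have PsiP (U : staircase_C3 C n) : {m : descending_mul n | Phi m = U}.
  apply: cid; have [m dm UE] := staircase_mul (svalP U).1 (svalP U).2.
  by exists (exist _ m dm); apply: sval_inj; rewrite UE.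
pose Psi U := sval (PsiP U); have PsiK : cancel Psi Phi by move=> U; exact: (svalP (PsiP U)).
have PhiM m : mul_of_gate (sval (Phi m)) (sval m) by apply: mul_of_gate_gate_fun (svalP m).
have PhiK : cancel Phi Psi.
  move=> m; apply: sval_inj; apply: (mul_of_gate_uniq (U := sval (Phi m))) => //.
  by rewrite -{1}(PsiK (Phi m)).
exists Phi, Psi; split=> // [m U|U m]; first exact: gate_of_mulP (svalP m).
rewrite -{1}(PsiK U); split=> [mU | ->]; last exact: PhiM.
exact: mul_of_gate_uniq mU (PhiM _).
Qed.
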